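(* Consider the distributed problem, with graph, edge weights, functions and constants as in the context: $\mathcal{G}=(\mathcal{V},\mathcal{E})$ is undirected and connected, $l,r\in\mathbb{R}^{|\mathcal{E}|}$ are element-wise positive, $X_0\subseteq\mathbb{R}^n$ is closed and convex, $\psi_0:X_0\to\mathbb{R}$ is proper, closed, continuously differentiable and $1$-strongly convex, each $f_i:X_0\to\mathbb{R}$ ($i\in\mathcal{V}$) is continuously differentiable, convex and $\beta$-smooth, and $(x^\star,u^\star)\in\mathbb{R}^{|\mathcal{V}|n}\times\mathbb{R}^{|\mathcal{E}|n}$ satisfies $$E_l(\mathcal{G})^\top x^\star=0,\qquad x^\star\in X,\qquad -E_l(\mathcal{G})u^\star-\nabla f(x^\star)\in N_X(x^\star).$$ Let $x^1\in X$, $u^1\in\mathbb{R}^{|\mathcal{E}|n}$ be deterministic, and let the sequences $(x^k)_{k\ge1},(u^k)_{k\ge1}$ be generated, for $k=1,2,\ldots$, by $$w^k=L_r(\mathcal{G})x^k+E_l(\mathcal{G})u^k+\nabla f(x^k)+\eta^k,$$ $$x^{k+1}=\operatorname{argmin}_{x\in X}\ \alpha^k\langle w^k,x\rangle+B_\psi(x,x^k),$$ $$u^{k+1}=u^k+\alpha^kE_l(\mathcal{G})^\top x^{k+1},$$ where the (deterministic) step sizes satisfy, for all $k$, $$0<\alpha^k\le\min\left\{\frac{1}{2(\beta+\lambda)},\frac1\gamma\right\},$$ and $\eta^1,\eta^2,\ldots$ are mutually independent random vectors in $\mathbb{R}^{|\mathcal{V}|n}$ with $\mathbb{E}[\eta^k]=0$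 and $\mathbb{E}\big[\|\eta^k\|_2^2\big]\le\sigma^2$ for all $k$. Then for every integer $K\ge1$, with $\overline{x}^K=\big(\sum_{k=1}^K\alpha^k\big)^{-1}\sum_{k=1}^K\alpha^kx^{k+1}$, $$\mathbb{E}[\ell(\overline{x}^K,u^\star)]-\ell(x^\star,u^\star)\le\frac{V(x^1,u^1)+\sigma^2\sum_{k=1}^K(\alpha^k)^2}{\sum_{k=1}^K\alpha^k}.$$
   Context: Superscripts $k$ on $\alpha^k$ are indices; $(\alpha^k)^2$ is the square of $\alpha^k$. $\mathcal{G}=(\mathcal{V},\mathcal{E})$ is an undirected graph with at least one edge (an edge is a pair of distinct nodes). Fix an arbitrary orientation of its edges; the incidence matrix $E(\mathcal{G})\in\mathbb{R}^{|\mathcal{V}|\times|\mathcal{E}|}$ has, in the column indexed by an edge, entry $1$ in the row of its head, $-1$ in the row of its tail, and $0$ elsewhere. For element-wise positive $l,r\in\mathbb{R}^{|\mathcal{E}|}$, let $$E_l(\mathcal{G})=(E(\mathcal{G})\,\mathrm{diag}(\sqrt l))\otimes I_n,\qquad L_r(\mathcal{G})=(E(\mathcal{G})\,\mathrm{diag}(r)\,E(\mathcal{G})^\top)\otimes I_n,$$ where $\sqrt l$ is the element-wise square root, $\mathrm{diag}(\cdot)$ is the diagonal matrix with the given diagonal, and $\otimes$ is the Kronecker product. Let $\frac1\gamma=\max\{\alpha\in\mathbb{R}:\alpha l\le r \text{ element-wise}\}$, and let $\lambda$ be the largest eigenvalue of $L_r(\mathcal{G})$. $X=X_0^{|\mathcal{V}|}$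 is the Cartesian product of $|\mathcal{V}|$ copies of $X_0$; for $x=[x_1^\top,\ldots,x_{|\mathcal{V}|}^\top]^\top\in X$ (each $x_i\in X_0$), $f(x)=\sum_{i\in\mathcal{V}}f_i(x_i)$ and $\psi(x)=\sum_{i\in\mathcal{V}}\psi_0(x_i)$. The underlying problem is to minimize $f(x)$ subject to $E_l(\mathcal{G})^\top x=0$, $x\in X$. $\psi_0$ is $1$-strongly convex if $\psi_0-\frac12\|\cdot\|_2^2$ is convex over $X_0$; $f_i$ is $\beta$-smooth (constant $\beta\ge0$) if $\frac\beta2\|\cdot\|_2^2-f_i$ is convex over $X_0$. The normal cone of $X$ at $x\in X$ is $N_X(x)=\{u:\langle u,x'-x\rangle\le0\ \forall x'\in X\}$. The Bregman divergence is $B_\psi(x',x)=\psi(x')-\psi(x)-\langle\nabla\psi(x),x'-x\rangle$. Lagrangian: $\ell(x,u)=f(x)+\langle E_l(\mathcal{G})u,x\rangle$. Energy function: $V(x,u)=B_\psi(x^\star,x)+\frac12\|u-u^\star\|_2^2$. *)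

(* Defs.v *)
From HB Require Import structures.
From mathcomp Require Import all_boot all_order all_algebra.
From mathcomp Require Import mxtens.
From mathcomp Require Import all_classical all_reals all_analysis.

Set Implicit Arguments.
Unset Strict Implicit.
Unset Printing Implicit Defensive.

Import Order.TTheory GRing.Theory Num.Theory.
Import numFieldNormedType.Exports.

Local Open Scope classical_set_scope.
Local Open Scope ring_scope.

Section Euclidean.
Variables (R : realType) (d : nat).
Implicit Types (u v : 'cV[R]_d).

(* The library norm `|u| on column vectors is the sup norm, hence dot/norm2. *)
Definition dot u v : R := (u^T *m v) 0 0.
Definition sqnorm u : R := dot u u.
Definition norm2 u : R := Num.sqrt (sqnorm u).

End Euclidean.

Section Graph.
Variables (N : nat) (E : {set {set 'I_N}}).

(* Nodes are 'I_N; an undirected edge is an unordered pair of distinct nodes. *)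
Definition undirected_graph : Prop := forall e, e \in E -> #|e| = 2%N.

Definition edge_rel : rel 'I_N := fun i j => [set i; j]%SET \in E.

Definition connected_graph : Prop := forall i j, connect edge_rel i j.

Definition orientation (hd tl : {set 'I_N} -> 'I_N) : Prop :=
  forall e, e \in E -> e = [set hd e; tl e]%SET.

End Graph.

Section GraphMatrices.
Variables (R : realType) (N : nat) (E : {set {set 'I_N}}).
Variables (hd tl : {set 'I_N} -> 'I_N).

(* Column j corresponds to the edge enum_val j of E. *)
Definition incidence : 'M[R]_(N, #|E|) :=
  \matrix_(i, j) if i == hd (enum_val j) then 1
                 else if i == tl (enum_val j) then -1 else 0.

Variable n : nat.

Definition weighted_incidence (l : 'rV[R]_#|E|) : 'M[R]_(N * n, #|E| * n) :=
  tensmx (incidence *m diag_mx (map_mx Num.sqrt l)) (1%:M : 'M[R]_n).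

Definition weighted_laplacian (r : 'rV[R]_#|E|) : 'M[R]_(N * n) :=
  tensmx (incidence *m diag_mx r *m incidence^T) (1%:M : 'M[R]_n).

End GraphMatrices.

Section Blocks.
Variables (R : realType) (N n : nat).

(* mxtens_index is the indexing used by tensmx, so that x is the stack of the
   block x 0, ..., block x (N - 1). *)
Definition block (x : 'cV[R]_(N * n)) (i : 'I_N) : 'cV[R]_n :=
  \col_j x (mxtens_index (i, j)) 0.

Definition block_power (X0 : set 'cV[R]_n) : set 'cV[R]_(N * n) :=
  [set x | forall i, X0 (block x i)].

Definition separable_sum (f : 'I_N -> 'cV[R]_n -> R) (x : 'cV[R]_(N * n)) : R :=
  \sum_i f i (block x i).

End Blocks.

Definition is_maximum (R : realType) (A : set R) (a : R) : Prop :=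
  A a /\ ubound A a.

(* A function h : A -> R is represented by a total function whose values
   outside A are never used. *)
Section FunctionsOnASet.
Variables (R : realType) (d : nat) (A : set 'cV[R]_d).
Implicit Types (h : 'cV[R]_d -> R) (g : 'cV[R]_d -> 'cV[R]_d).

Definition ext_pinfty h (x : 'cV[R]_d) : \bar R :=
  if x \in A then (h x)%:E else +oo%E.

Definition proper_function h : Prop :=
  (forall x, ext_pinfty h x <> -oo%E) /\ (exists x, (ext_pinfty h x < +oo)%E).

Definition closed_function h : Prop :=
  closed [set p : 'cV[R]_d * R | (ext_pinfty h p.1 <= p.2%:E)%E].

(* A may have boundary points or empty interior, so differentiability is
   relative to A.  If A has empty interior, g is then not unique, but for
   convex A the values dot (g x) (y - x), x and y in A, are. *)
Definition C1_gradient h g : Prop :=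
  (forall x, A x -> forall eps : R, 0 < eps ->
     \forall y \near within A (nbhs x),
       `|h y - h x - dot (g x) (y - x)| <= eps * norm2 (y - x)) /\
  {within A, continuous g}.

Definition continuously_differentiable h : Prop := exists g, C1_gradient h g.

Definition strongly_convex1 h : Prop :=
  convex_function A (fun x : 'cV[R]_d => h x - 2^-1 * sqnorm x).

Definition smooth (beta : R) h : Prop :=
  convex_function A (fun x : 'cV[R]_d => beta / 2 * sqnorm x - h x).

Definition normal_cone (x : 'cV[R]_d) : set 'cV[R]_d :=
  [set u | forall y, A y -> dot u (y - x) <= 0].

Definition is_argmin h (x : 'cV[R]_d) : Prop :=
  A x /\ forall y, A y -> h x <= h y.

End FunctionsOnASet.

Definition bregman (R : realType) (d : nat) (psi : 'cV[R]_d -> R)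
    (gradpsi : 'cV[R]_d -> 'cV[R]_d) (y x : 'cV[R]_d) : R :=
  psi y - psi x - dot (gradpsi x) (y - x).

Definition lagrangian (R : realType) (p q : nat) (f : 'cV[R]_p -> R)
    (El : 'M[R]_(p, q)) (x : 'cV[R]_p) (u : 'cV[R]_q) : R :=
  f x + dot (El *m u) x.

Definition energy (R : realType) (p q : nat) (psi : 'cV[R]_p -> R)
    (gradpsi : 'cV[R]_p -> 'cV[R]_p) (xstar : 'cV[R]_p) (ustar : 'cV[R]_q)
    (x : 'cV[R]_p) (u : 'cV[R]_q) : R :=
  bregman psi gradpsi xstar x + 2^-1 * sqnorm (u - ustar).

Section RandomVectors.
Variables (R : realType) (dT : measure_display) (T : measurableType dT).
Variables (P : probability T R) (d : nat).

Definition borel_cV := g_sigma_algebraType (@open 'cV[R]_d).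

Definition random_vector (Z : T -> 'cV[R]_d) : Prop :=
  measurable_fun [set: T] (Z : T -> borel_cV).

Definition mutually_independent (Z : nat -> T -> 'cV[R]_d) : Prop :=
  forall (s : seq nat) (B : nat -> set borel_cV), uniq s ->
    (forall k, k \in s -> measurable (B k)) ->
    P (\bigcap_(k in [set` s]) Z k @^-1` B k) =
      (\prod_(k <- s) P (Z k @^-1` B k))%E.

End RandomVectors.

(* Main.v *)
(* For one step, optimality of x^(k+1) in the mirror step, convexity and
   smoothness of f, and strong convexity of psi give
     alpha_k (l(x^(k+1), ustar) - l(xstar, ustar)) <=
       V(x^k, u^k) - V(x^(k+1), u^(k+1)) - alpha_k <eta^k, x^k - xstar> + alpha_k^2 |eta^k|^2;
   the dual update costs (alpha_k^2 / 2) |E_l^T x^(k+1)|^2, which is paid for by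
   the Laplacian term because alpha_k l <= r.  The proximal map is nonexpansive
   and the gradients are continuous on X, so x^k is measurable with respect to
   eta^1, ..., eta^(k-1); together with the integrable bound on the energies
   that follows from the same inequality, independence and E eta^k = 0 make
   the expectation of the inner product vanish.  Telescoping and Jensen's
   inequality conclude. *)
Require Import Defs.
From HB Require Import structures.
From mathcomp Require Import all_boot all_order all_algebra.
From mathcomp Require Import mxtens ring lra.
From mathcomp Require Import all_classical all_reals all_analysis.
From mathcomp Require Import measurable_realfun.
Import Order.TTheory GRing.Theory Num.Theory.
Import numFieldNormedType.Exports.
Local Open Scope classical_set_scope.
Local Open Scope ring_scope.

Set Implicit Arguments.
Unset Strict Implicit.
Unset Printing Implicit Defensive.

(** * Euclidean geometry and first-order convexity *)

Section DotProduct.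
Variables (R : realType) (d : nat).
Implicit Types (u v w : 'cV[R]_d) (a : R).

Lemma dotE u v : dot u v = \sum_i u i 0 * v i 0.
Proof. by rewrite /dot mxE; apply: eq_bigr => i _; rewrite mxE. Qed.

Lemma dotC u v : dot u v = dot v u.
Proof. by rewrite !dotE; apply: eq_bigr => i _; rewrite mulrC. Qed.

Lemma dotDl u v w : dot (u + v) w = dot u w + dot v w.
Proof. by rewrite !dotE -big_split; apply: eq_bigr => i _; rewrite mxE mulrDl. Qed.

Lemma dotZl a u v : dot (a *: u) v = a * dot u v.
Proof. by rewrite !dotE big_distrr; apply: eq_bigr => i _; rewrite mxE -mulrA. Qed.

Lemma dotNl u v : dot (- u) v = - dot u v.
Proof. by rewrite -scaleN1r dotZl mulN1r. Qed.

Lemma dotDr u v w : dot u (v + w) = dot u v + dot u w.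
Proof. by rewrite dotC dotDl !(dotC u). Qed.

Lemma dotZr a u v : dot u (a *: v) = a * dot u v.
Proof. by rewrite dotC dotZl dotC. Qed.

Lemma dotNr u v : dot u (- v) = - dot u v.
Proof. by rewrite dotC dotNl dotC. Qed.

Lemma dot0l v : dot 0 v = 0.
Proof. by rewrite dotE big1// => i _; rewrite mxE mul0r. Qed.

Lemma dot0r v : dot v 0 = 0.
Proof. by rewrite dotC dot0l. Qed.

Definition dot_linear := (dotDl, dotDr, dotNl, dotNr, dotZl, dotZr).

Lemma sqnormE u : sqnorm u = \sum_i u i 0 ^+ 2.
Proof. by rewrite /sqnorm dotE. Qed.

Lemma sqnorm_ge0 u : 0 <= sqnorm u.
Proof. by rewrite sqnormE sumr_ge0// => i _; exact: sqr_ge0. Qed.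

Lemma sqnorm_eq0 u : sqnorm u = 0 -> u = 0.
Proof.
rewrite sqnormE => /eqP; rewrite psumr_eq0; last by move=> i _; exact: sqr_ge0.
move=> /allP u0; apply/colP => i; rewrite mxE.
by apply/eqP; rewrite -sqrf_eq0; apply: (implyP (u0 i (mem_index_enum i))).
Qed.

Lemma le_sqr_sqnorm u i : u i 0 ^+ 2 <= sqnorm u.
Proof.
by rewrite sqnormE (bigD1 i)//= lerDl sumr_ge0// => j _; exact: sqr_ge0.
Qed.

Lemma sqnormN u : sqnorm (- u) = sqnorm u.
Proof. by rewrite /sqnorm !dot_linear opprK. Qed.

Lemma dot_young u v : `|dot u v| <= 2^-1 * sqnorm u + 2^-1 * sqnorm v.
Proof.
have := sqnorm_ge0 (u - v); have := sqnorm_ge0 (u + v).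
rewrite /sqnorm !dot_linear (dotC v u) ler_norml => ? ?.
by apply/andP; split; lra.
Qed.

Lemma norm2Z a u : 0 <= a -> norm2 (a *: u) = a * norm2 u.
Proof.
move=> a0; rewrite /norm2 /sqnorm !dot_linear mulrA sqrtrM ?mulr_ge0//.
by rewrite -expr2 sqrtr_sqr ger0_norm.
Qed.

End DotProduct.

Lemma dot_mulmxl (R : realType) (p q : nat) (A : 'M[R]_(p, q)) u v :
  dot (A *m u) v = dot u (A^T *m v).
Proof. by rewrite /dot trmx_mul mulmxA. Qed.

(** * Convex combinations written as displacements along a segment *)

Section ConvexSegments.
Variables (R : realType) (d : nat) (X : set 'cV[R]_d).
Implicit Types (x y : 'cV[R]_d) (h : 'cV[R]_d -> R) (s : R).

Lemma convex_set_segment x y s : convex_set X -> X x -> X y -> 0 <= s <= 1 ->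
  X (x + s *: (y - x)).
Proof.
move=> cX Xx Xy /andP[s0 s1].
have s01 : Itv.spec (@Itv.num_sem R) (Itv.Real `[0%Z, 1%Z]) s.
  by apply/and3P; rewrite ?ger0_real//= ?bnd_simp s0 s1.
have := cX y x (Itv.mk s01); rewrite !inE => /(_ Xy Xx).
rewrite /conv/= /unstable.onem scalerBl scale1r scalerBr.
by rewrite addrCA addrA addrAC -addrA.
Qed.

Lemma convex_function_segment h x y s : convex_function X h ->
  X x -> X y -> 0 <= s <= 1 ->
  h (x + s *: (y - x)) <= (1 - s) * h x + s * h y.
Proof.
move=> ch Xx Xy /andP[s0 s1].
have s01 : Itv.spec (@Itv.num_sem R) (Itv.Real `[0%Z, 1%Z]) s.
  by apply/and3P; rewrite ?ger0_real//= ?bnd_simp s0 s1.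
have := ch (Itv.mk s01) y x; rewrite !inE => /(_ Xy Xx).
rewrite /conv/= /unstable.onem scalerBl scale1r.
set a := _ + _; set b := x + _.
have -> : a = b by rewrite /a /b scalerBr addrCA addrA addrAC -addrA.
by rewrite [X in _ <= X -> _]addrC.
Qed.

End ConvexSegments.


(** * First-order inequalities within a convex set *)

Section FirstOrder.
Variables (R : realType) (d : nat) (X : set 'cV[R]_d).
Variables (h : 'cV[R]_d -> R) (g : 'cV[R]_d -> 'cV[R]_d).
Hypotheses (cX : convex_set X) (hg : C1_gradient X h g).
Implicit Types (x y : 'cV[R]_d) (s c : R).

(** The segment towards [y] stays in [X], so differentiability relative to [X] applies along it. The
    tolerance is divided by the Euclidean length of [v], the radius by its sup norm; the [+ 1] in
    both covers [v = 0]. *)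
Lemma C1_gradient_dir x y eps : X x -> X y -> 0 < eps ->
  exists2 delta : R, 0 < delta & forall s, 0 < s < delta -> s <= 1 ->
    `|h (x + s *: (y - x)) - h x - s * dot (g x) (y - x)| <= eps * s.
Proof.
move=> Xx Xy eps0; set v := y - x.
have n0 : 0 <= norm2 v by rewrite sqrtr_ge0.
have e0 : 0 < eps / (norm2 v + 1) by rewrite divr_gt0// ltr_wpDl.
have [+ _] := hg => /(_ x Xx _ e0); rewrite /within/= => /nbhs_ballP[rho rho0 near].
exists (rho / (`|v| + 1)); first by rewrite divr_gt0// ltr_wpDl.
move=> s /andP[s0]; rewrite ltr_pdivlMr ?ltr_wpDl// => srho s1.
have /near : ball x rho (x + s *: v).
  rewrite -ball_normE/= opprD addrA subrr add0r normrN normrZ gtr0_norm//.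
  by apply: le_lt_trans srho; rewrite ler_wpM2l ?(ltW s0)// lerDl.
have Xs : X (x + s *: v) by apply: convex_set_segment => //; rewrite ltW.
move=> /(_ Xs); rewrite (addrC x) addrK dotZr norm2Z ?(ltW s0)// => /le_trans; apply.
rewrite mulrCA (mulrC eps s) ler_pM2l// mulrAC ler_pdivrMr ?ltr_wpDl//.
by rewrite ler_pM2l// lerDl.
Qed.

(* Since [c * sqnorm] is quadratic, its chord excess at parameter [s] is
   exactly [c * s * (1 - s) * sqnorm (y - x)]. *)
Lemma weakly_convex_first_order c x y :
  convex_function X (fun z => h z + c * sqnorm z) -> X x -> X y ->
  dot (g x) (y - x) <= h y - h x + c * sqnorm (y - x).
Proof.
move=> ch Xx Xy; apply/ler_addgt0Pr => eps eps0.
have e20 : 0 < eps / 2 by rewrite divr_gt0.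
have [dlt dlt0 near] := C1_gradient_dir Xx Xy e20.
set q := sqnorm (y - x); have q0 : 0 <= q := sqnorm_ge0 _.
(* Divided by [s], the chord excess is [c * q - c * s * q]. The bound [s <= b] keeps [- (c * s * q)]
   below [eps / 2] for either sign of [c]; differentiability costs the other [eps / 2]. *)
pose b := eps / 2 / (`|c| * q + 1).
have cq0 : 0 < `|c| * q + 1 by rewrite ltr_wpDl// mulr_ge0.
have b0 : 0 < b by rewrite divr_gt0.
pose s := Num.min (dlt / 2) (Num.min 1 b).
have s0 : 0 < s by rewrite !lt_min b0 ltr01 divr_gt0.
have s1 : s <= 1 by rewrite !ge_min lexx orbT.
have sb : s <= b by rewrite !ge_min lexx !orbT.
have sdlt : s < dlt.
  by apply: (@le_lt_trans _ _ (dlt / 2)); [rewrite ge_min lexx|lra].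
have := near s; rewrite s0 sdlt s1 => /(_ isT isT).
have := convex_function_segment ch Xx Xy (s := s); rewrite (ltW s0) s1 => /(_ isT).
have -> : sqnorm (x + s *: (y - x)) =
    (1 - s) * sqnorm x + s * sqnorm y - s * (1 - s) * q.
  by rewrite /q /sqnorm !dot_linear (dotC y x); ring.
move: sb; rewrite /b ler_pdivlMr// => sb.
have : - (c * s * q) <= eps / 2.
  apply: (le_trans _ sb); rewrite mulrDr mulr1.
  have : - c * (s * q) <= `|c| * (s * q).
    by rewrite ler_wpM2r ?mulr_ge0 ?(ltW s0)// -normrN ler_norm.
  by move=> ?; nra.
rewrite ler_norml => cs /= hcv /andP[hlo _].
rewrite -(ler_pM2l s0); nra.
Qed.

(** The objective cannot decrease from [x] along a segment of [X]; dividing its expansion by [s]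
    gives the inequality up to any [eps]. The constant [c0] makes room for the terms of a Bregman
    divergence that do not depend on [z]. *)
Lemma argmin_first_order (p x : 'cV[R]_d) c0 :
  is_argmin X (fun z => dot p z + h z + c0) x ->
  forall y, X y -> 0 <= dot (p + g x) (y - x).
Proof.
move=> [Xx xmin] y Xy; apply/ler_addgt0Pr => eps eps0.
have [dlt dlt0 near] := C1_gradient_dir Xx Xy eps0.
pose s := Num.min (dlt / 2) 1.
have s0 : 0 < s by rewrite !lt_min ltr01 divr_gt0.
have s1 : s <= 1 by rewrite !ge_min lexx orbT.
have sdlt : s < dlt.
  by apply: (@le_lt_trans _ _ (dlt / 2)); [rewrite ge_min lexx|lra].
have := near s; rewrite s0 sdlt s1 => /(_ isT isT).
have := xmin (x + s *: (y - x)).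
have Xs : X (x + s *: (y - x)) by apply: convex_set_segment => //; rewrite (ltW s0).
move=> /(_ Xs); rewrite ler_norml => mn /andP[_ hi].
rewrite -(ler_pM2l s0); move: mn hi; rewrite !dot_linear => mn hi.
nra.
Qed.

End FirstOrder.


(** * Graph matrices *)

Section Rayleigh.
Variables (R : realType) (d : nat).
Implicit Type A : 'M[R]_d.

(** Stated on rows because both the compactness argument and [eigenvalue] below use row vectors. *)
Lemma continuous_quadratic_form A :
  continuous (fun v : 'rV[R]_d => dot (A *m v^T) v^T).
Proof.
have -> : (fun v : 'rV[R]_d => dot (A *m v^T) v^T) =
    (fun v => \sum_i (\sum_j A i j * v 0 j) * v 0 i).
  apply/funext => v; rewrite dotE; apply: eq_bigr => i _; rewrite !mxE.
  by congr (_ * _); apply: eq_bigr => j _; rewrite mxE.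
apply: continuous_big => [|i _]; first exact: add_continuous.
have cA : continuous (fun v : 'rV[R]_d => \sum_j A i j * v 0 j).
  apply: continuous_big => [|j _]; first exact: add_continuous.
  by move=> v; exact: (cvgM (cvg_cst _) (@coord_continuous _ _ _ 0 j v)).
by move=> v; exact: (cvgM (cA v) (@coord_continuous _ _ _ 0 i v)).
Qed.

(* The Rayleigh quotient attains its maximum [mu] on the unit sphere; at a
   maximizer [v] the form [mu - A] is nonnegative and vanishes at [v], so that
   [v] lies in its kernel and [mu] is an eigenvalue. *)
Lemma le_max_eigenvalue A lambda (x : 'cV[R]_d) : A^T = A ->
  (forall mu, eigenvalue A mu -> mu <= lambda) ->
  dot (A *m x) x <= lambda * sqnorm x.
Proof.
move=> symA hlambda.
have dotA u v : dot (A *m u) v = dot (A *m v) u.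
  by rewrite dot_mulmxl symA dotC.
have [->|x0] := eqVneq x 0; first by rewrite mulmx0 /sqnorm !dot0l mulr0.
have qx0 : 0 < sqnorm x.
  rewrite lt_def sqnorm_ge0 andbT; apply: contra_neq x0; exact: sqnorm_eq0.
pose S := [set v : 'rV[R]_d | sqnorm v^T = 1].
have S0 : S !=set0.
  exists ((Num.sqrt (sqnorm x))^-1 *: x)^T; rewrite /S/= trmxK /sqnorm !dot_linear.
  rewrite mulrA -invfM -expr2 sqr_sqrtr ?sqnorm_ge0// mulVf// gt_eqF//.
have Scl : closed S.
  have -> : S = (fun v : 'rV[R]_d => dot (1%:M *m v^T) v^T) @^-1` [set 1].
    by apply/seteqP; split => v; rewrite /S /sqnorm/= mul1mx.
  by move/continuous_closedP : (@continuous_quadratic_form 1%:M); apply; exact: closed_eq.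
have Sbd : bounded_set S.
  exists 1; split; first exact: num_real.
  move=> M /ltW M1 v /= Sv; apply: le_trans M1.
  rewrite -[`|v|]/(mx_norm v) mx_normrE; apply/bigmax_leP; split => // -[i j] _ /=.
  rewrite (ord1 i) -(ler_sqr (x := `|_|)) ?nnegrE// expr1n real_normK ?num_real//.
  by have := le_sqr_sqnorm v^T j; rewrite mxE Sv.
have [v] := compact_EVT_max S0 (bounded_closed_compact Sbd Scl)
  (continuous_subspaceT (@continuous_quadratic_form A)).
rewrite inE => Sv vmax.
set mu := dot (A *m v^T) v^T in vmax.
have Amu y : dot (A *m y) y <= mu * sqnorm y.
  have [->|y0] := eqVneq y 0; first by rewrite mulmx0 /sqnorm !dot0l mulr0.
  have qy0 : 0 < sqnorm y.
    rewrite lt_def sqnorm_ge0 andbT; apply: contra_neq y0; exact: sqnorm_eq0.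
  have q2 : (Num.sqrt (sqnorm y))^-1 * (Num.sqrt (sqnorm y))^-1 = (sqnorm y)^-1.
    by rewrite -invfM -expr2 sqr_sqrtr ?sqnorm_ge0.
  have := vmax ((Num.sqrt (sqnorm y))^-1 *: y)^T; rewrite inE /S/= trmxK.
  rewrite -scalemxAr /sqnorm !dot_linear !mulrA q2 mulVf ?gt_eqF// => /(_ erefl).
  by rewrite ler_pdivrMl// mulrC.
have kerv y : dot (mu *: v^T - A *m v^T) y = 0.
  have sq1 : dot v^T v^T = 1 by exact: Sv.
  have pos s : 0 <= 2 * s * dot (mu *: v^T - A *m v^T) y +
                    s ^+ 2 * (mu * sqnorm y - dot (A *m y) y).
    have := Amu (v^T + s *: y).
    rewrite mulmxDr -scalemxAr /sqnorm !dot_linear (dotA y) (dotC y) sq1 -/mu.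
    by move=> ?; nra.
  set a := dot _ y in pos *; set b := _ - _ in pos.
  have b0 : 0 <= b by rewrite subr_ge0.
  (* At this [s] the nonnegative polynomial [2 * s * a + s ^+ 2 * b] equals
     [- (a ^+ 2 * c * (1 + c))], which forces [a = 0]. The [+ 1] keeps the denominator positive when
     [b = 0]. *)
  have := pos (- a / (b + 1)).
  set c := (b + 1)^-1; have c0 : 0 < c by rewrite invr_gt0 ltr_wpDl.
  have bc : b * c = 1 - c by rewrite /c; field; rewrite gt_eqF// ltr_wpDl.
  have -> : 2 * (- a * c) * a + (- a * c) ^+ 2 * b = a ^+ 2 * c * (b * c - 2) by ring.
  have -> : a ^+ 2 * c * (b * c - 2) = - (a ^+ 2 * c * (1 + c)) by rewrite bc; ring.
  rewrite oppr_ge0 pmulr_lle0 ?addr_gt0// pmulr_lle0// => a2.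
  by apply/eqP; rewrite -sqrf_eq0 eq_le a2 sqr_ge0.
have Av : A *m v^T = mu *: v^T.
  by apply/esym/eqP; rewrite -subr_eq0; apply/eqP/sqnorm_eq0/kerv.
apply: (le_trans (Amu x)); rewrite ler_wpM2r ?sqnorm_ge0//.
apply: hlambda; apply/eigenvalueP; exists v.
  by rewrite -[LHS]trmxK trmx_mul symA Av linearZ/= trmxK.
apply/eqP => v0; move: Sv; rewrite /S/= v0 /sqnorm trmx0 dot0l.
by move=> /eqP; rewrite eq_sym oner_eq0.
Qed.

End Rayleigh.

Section TensorDiag.
Variables (R : realType) (p q n : nat).

Lemma tensmx_diag1 (v : 'rV[R]_p) :
  tensmx (diag_mx v) (1%:M : 'M[R]_n) = diag_mx (\row_k v 0 (mxtens_unindex k).1).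
Proof.
apply/matrixP => i j; case: (mxtens_indexP i) => i0 i1; case: (mxtens_indexP j) => j0 j1.
rewrite tensmxE !mxE mxtens_indexK/= (can_eq (@mxtens_indexK _ _)) xpair_eqE.
by case: (i0 == j0); case: (i1 == j1); rewrite ?mulr1n ?mulr0n ?mulr1 ?mulr0 ?mul0r.
Qed.

End TensorDiag.


Section WeightedGraph.
Variables (R : realType) (N : nat) (E : {set {set 'I_N}}).
Variables (hd tl : {set 'I_N} -> 'I_N) (n : nat) (l r : 'rV[R]_#|E|).

Let El := weighted_incidence hd tl n l.
Let Lr := weighted_laplacian hd tl n r.
(** Common unweighted factor of [El] and [Lr]: the weights enter only through diagonal matrices on
    the edge side, so the two can be compared coordinate by coordinate. *)
Let D : 'M[R]_(N * n, #|E| * n) := tensmx (incidence R E hd tl) 1%:M.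

Lemma weighted_incidence_trE k (x : 'cV[R]_(N * n)) :
  (El^T *m x) k 0 = Num.sqrt (l 0 (mxtens_unindex k).1) * (D^T *m x) k 0.
Proof.
have -> : El = D *m diag_mx (\row_j (map_mx Num.sqrt l) 0 (mxtens_unindex j).1).
  by rewrite -tensmx_diag1 tensmx_mul mulmx1.
by rewrite trmx_mul tr_diag_mx -mulmxA mul_diag_mx !mxE.
Qed.

Lemma weighted_laplacianE : Lr = D *m diag_mx (\row_j r 0 (mxtens_unindex j).1) *m D^T.
Proof. by rewrite -tensmx_diag1 trmx_tens trmx1 !tensmx_mul !mulmx1. Qed.

Lemma trmx_weighted_laplacian : Lr^T = Lr.
Proof. by rewrite weighted_laplacianE !trmx_mul trmxK tr_diag_mx mulmxA. Qed.

Lemma dot_weighted_laplacian x y : dot (Lr *m x) y =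
  \sum_k r 0 (mxtens_unindex k).1 * (D^T *m x) k 0 * (D^T *m y) k 0.
Proof.
rewrite weighted_laplacianE -2!mulmxA dot_mulmxl dotE; apply: eq_bigr => k _.
by rewrite mul_diag_mx !mxE.
Qed.

Lemma weighted_laplacian_ge0 x : (forall j, 0 < r 0 j) -> 0 <= dot (Lr *m x) x.
Proof.
move=> r0; rewrite dot_weighted_laplacian sumr_ge0// => k _.
by rewrite -mulrA mulr_ge0 ?(ltW (r0 _))// -expr2 sqr_ge0.
Qed.

(** Positive weights make the kernels of [El^T] and [D^T] coincide, and [Lr] ends with the factor
    [D^T]. *)
Lemma weighted_laplacian_eq0 (x : 'cV[R]_(N * n)) : (forall j, 0 < l 0 j) ->
  El^T *m x = 0 -> Lr *m x = 0.
Proof.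
move=> l0 Ex; suff Dx : D^T *m x = 0 by rewrite weighted_laplacianE -mulmxA Dx mulmx0.
apply/colP => k; rewrite [RHS]mxE; apply/eqP.
have /eqP := weighted_incidence_trE k x; rewrite Ex mxE eq_sym mulf_eq0.
by rewrite gt_eqF// sqrtr_gt0.
Qed.

(** Both sides are weighted sums of the same squares of [D^T *m x], with weights [a * l] and [r].
    This is where the bound [1 / gamma] on the step size acts. *)
Lemma weighted_incidence_le_laplacian a (x : 'cV[R]_(N * n)) : 0 <= a ->
  (forall j, 0 < l 0 j) -> (forall j, a * l 0 j <= r 0 j) ->
  a * sqnorm (El^T *m x) <= dot (Lr *m x) x.
Proof.
move=> a0 l0 alr; rewrite dot_weighted_laplacian sqnormE mulr_sumr ler_sum// => k _.
rewrite weighted_incidence_trE exprMn sqr_sqrtr ?(ltW (l0 _))// mulrA.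
rewrite -[leRHS]mulrA -expr2.
by rewrite ler_wpM2r// sqr_ge0.
Qed.

End WeightedGraph.

(** * Passing from one node to the product space *)

Section SeparableSums.
Variables (R : realType) (N n : nat) (X0 : set 'cV[R]_n).
Hypothesis cX0 : convex_set X0.
Implicit Types x y : 'cV[R]_(N * n).

Lemma block_conv x y (t : {i01 R}) (i : 'I_N) :
  block (conv t (x : convex_lmodType _) y) i =
  conv t (block x i : convex_lmodType _) (block y i).
Proof. by apply/colP => j; rewrite /conv/= !mxE. Qed.

Lemma sqnorm_block x : sqnorm x = \sum_i sqnorm (block x i).
Proof.
rewrite sqnormE (reindex (@mxtens_index N n)) /=; last first.
  exists (@mxtens_unindex N n) => k _; [exact: mxtens_indexK|exact: mxtens_unindexK].
transitivity (\sum_(i < N) \sum_(j < n) x (mxtens_index (i, j)) 0 ^+ 2).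
  by rewrite pair_bigA; apply: eq_bigr => -[].
by apply: eq_bigr => i _; rewrite sqnormE; apply: eq_bigr => j _; rewrite mxE.
Qed.

Lemma convex_block_power : convex_set (block_power (N := N) X0).
Proof.
move=> x y t; rewrite !inE => Xx Xy i; rewrite block_conv.
by have := cX0 t (mem_set (Xx i)) (mem_set (Xy i)); rewrite inE.
Qed.

Lemma convex_separable_sum (h : 'I_N -> 'cV[R]_n -> R) :
  (forall i, convex_function X0 (h i)) ->
  convex_function (block_power (N := N) X0) (separable_sum h).
Proof.
move=> ch t x y; rewrite !inE => Xx Xy.
rewrite convRE /separable_sum !mulr_sumr -big_split ler_sum// => i _.
rewrite block_conv; have := ch i t _ _ (mem_set (Xx i)) (mem_set (Xy i)).
by rewrite convRE.
Qed.

End SeparableSums.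


(** * One step of the algorithm *)

Section OneStep.
Variables (R : realType) (p q : nat) (X : set 'cV[R]_p).
Variables (f psi : 'cV[R]_p -> R) (gradf gradpsi : 'cV[R]_p -> 'cV[R]_p).
Variables (El : 'M[R]_(p, q)) (Lr : 'M[R]_p) (beta lambda : R).
Variables (xstar : 'cV[R]_p) (ustar : 'cV[R]_q).
Hypotheses (cX : convex_set X) (hgradf : C1_gradient X f gradf)
  (hgradpsi : C1_gradient X psi gradpsi).
Hypotheses (cvxf : convex_function X f)
  (smf : convex_function X (fun z => beta / 2 * sqnorm z - f z))
  (scpsi : convex_function X (fun z => psi z - 2^-1 * sqnorm z)).
Hypotheses (symL : Lr^T = Lr) (L_ge0 : forall y, 0 <= dot (Lr *m y) y)
  (L_le : forall y, dot (Lr *m y) y <= lambda * sqnorm y).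
Hypotheses (Exs : El^T *m xstar = 0) (Lxs : Lr *m xstar = 0) (Xxs : X xstar)
  (opt : normal_cone X xstar (- (El *m ustar) - gradf xstar)).
Let V := energy psi gradpsi xstar ustar.
Let lag x := lagrangian f El x ustar.

Lemma convex_gradient_ineq x y : X x -> X y ->
  dot (gradf x) (y - x) <= f y - f x.
Proof.
move=> Xx Xy; have := @weakly_convex_first_order _ _ _ _ _ cX hgradf 0 x y.
rewrite mul0r addr0; apply => //.
by under eq_fun do rewrite mul0r addr0.
Qed.

(** The first-order inequality for [- f], with [c = beta / 2]. *)
Lemma smooth_gradient_ineq x y : X x -> X y ->
  f y - f x - beta / 2 * sqnorm (y - x) <= dot (gradf x) (y - x).
Proof.
move=> Xx Xy; have hN : C1_gradient X (fun z => - f z) (fun z => - gradf z).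
  split; last by move=> z; apply: cvgN; exact: hgradf.2.
  move=> z Xz e e0; have := hgradf.1 z Xz e e0.
  by apply: filterS => t; rewrite dotNl -!opprD normrN.
have := @weakly_convex_first_order _ _ _ _ _ cX hN (beta / 2) x y.
under eq_fun do rewrite addrC.
by move=> /(_ smf Xx Xy); rewrite dotNl; lra.
Qed.

Lemma bregman_ge x y : X x -> X y -> 2^-1 * sqnorm (y - x) <= bregman psi gradpsi y x.
Proof.
move=> Xx Xy; have := @weakly_convex_first_order _ _ _ _ _ cX hgradpsi (- 2^-1) x y.
under eq_fun do rewrite mulNr.
by move=> /(_ scpsi Xx Xy); rewrite /bregman; lra.
Qed.

(** Strong convexity of [psi] is what bounds the distance to [xstar]; the integrability of the noise
    products rests on this. *)
Lemma energy_ge x u : X x -> 2^-1 * sqnorm (x - xstar) <= V x u.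
Proof.
move=> Xx; have := bregman_ge Xx Xxs; rewrite -sqnormN opprB /V /energy.
by have := sqnorm_ge0 (u - ustar); lra.
Qed.

(** The normal cone condition is first-order optimality of [xstar] for the convex function [lag]
    over [X]. *)
Lemma lagrangian_ge x : X x -> lag xstar <= lag x.
Proof.
move=> Xx; have := opt Xx; have := convex_gradient_ineq Xxs Xx.
by rewrite /lag /lagrangian !dot_linear; lra.
Qed.

Lemma mirror_step_variational c w x x' y :
  is_argmin X (fun z => c * dot w z + bregman psi gradpsi z x) x' -> X y ->
  0 <= dot (c *: w - gradpsi x + gradpsi x') (y - x').
Proof.
move=> hx' Xy.
(* The terms of the Bregman divergence constant in [z] form [c0]; its linear term joins [c *: w]. *)
apply: (@argmin_first_order _ _ _ _ _ cX hgradpsi _ _ (dot (gradpsi x) x - psi x)) => //.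
case: hx' => Xx' min; split=> // z Xz; have := min z Xz.
by rewrite /bregman !dot_linear; lra.
Qed.

(** Each variational inequality is tested at the other minimizer. Their sum, the strong monotonicity
    of [gradpsi] (two uses of [bregman_ge]) and Young's inequality give the bound. It makes the
    minimizer a continuous function of [c *: w - gradpsi x], hence measurable. *)
Lemma mirror_step_nonexpansive c1 w1 x1 y1 c2 w2 x2 y2 :
  is_argmin X (fun z => c1 * dot w1 z + bregman psi gradpsi z x1) y1 ->
  is_argmin X (fun z => c2 * dot w2 z + bregman psi gradpsi z x2) y2 ->
  sqnorm (y1 - y2) <=
  sqnorm ((c1 *: w1 - gradpsi x1) - (c2 *: w2 - gradpsi x2)).
Proof.
move=> h1 h2; have [Xy1 _] := h1; have [Xy2 _] := h2.
have := mirror_step_variational h1 Xy2; have := mirror_step_variational h2 Xy1.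
have := bregman_ge Xy1 Xy2; have := bregman_ge Xy2 Xy1.
rewrite -(sqnormN (y1 - y2)) opprB /bregman.
set p1 := c1 *: w1 - _; set p2 := c2 *: w2 - _.
have := dot_young (p1 - p2) (y2 - y1); rewrite ler_norml => /andP[_].
rewrite -(opprB y2 y1) !dot_linear; lra.
Qed.

Section Step.
Variables (a : R) (x x' eta : 'cV[R]_p) (u u' : 'cV[R]_q).
Hypotheses (a0 : 0 < a) (ale : a * (beta + lambda) <= 2^-1)
  (aE : forall y, a * sqnorm (El^T *m y) <= dot (Lr *m y) y) (Xx : X x).
Hypothesis hx' : is_argmin X (fun z =>
  a * dot (Lr *m x + El *m u + gradf x + eta) z + bregman psi gradpsi z x) x'.
Hypothesis hu' : u' = u + a *: (El^T *m x').

(* The strong convexity of [psi] contributes [-1/2 * sqnorm (x' - x)]; the step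
   size lets [beta] and [lambda] consume half of it, and Young's inequality
   spends the other half on [dot eta (x' - x)]. *)
Lemma one_step_descent :
  a * (lag x' - lag xstar) <=
  V x u - V x' u' - a * dot eta (x - xstar) + a ^+ 2 * sqnorm eta.
Proof.
have Xx' : X x' by case: hx'.
have := mirror_step_variational hx' Xxs.
have := ler_wpM2l (ltW a0) (convex_gradient_ineq Xx Xxs).
have := ler_wpM2l (ltW a0) (smooth_gradient_ineq Xx Xx').
have := bregman_ge Xx Xx'.
have := sqnorm_ge0 (a *: eta + 2^-1 *: (x' - x)).
(* As [Lr] is symmetric and kills [xstar], the Laplacian contributes [- dot (Lr *m x) x']: half the
   form at [x' - x] minus half the forms at [x] and [x']. The first is bounded through [lambda], the
   one at [x] is dropped, and the one at [x'] pays for the dual update. *)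
have := ler_wpM2l (ltW a0) (L_ge0 x).
have := ler_wpM2l (ltW a0) (L_le (x' - x)).
have := ler_wpM2l (ltW a0) (aE x').
have := ler_wpM2r (sqnorm_ge0 (x' - x)) ale.
have Lsym y z : dot (Lr *m y) z = dot (Lr *m z) y by rewrite dot_mulmxl symL dotC.
have Lxs0 : dot (Lr *m x) xstar = 0 by rewrite Lsym Lxs dot0l.
have Es0 v : dot v (El^T *m xstar) = 0 by rewrite Exs dot0r.
have EE v z : dot (El *m v) z = dot v (El^T *m z) := dot_mulmxl _ _ _.
rewrite hu' /V /lag /energy /lagrangian /bregman /sqnorm.
rewrite mulmxBr !dot_linear !EE !Es0 Lxs0 (Lsym x' x) (dotC x' x) (dotC x eta) (dotC x' eta).
set e := El^T *m x'; rewrite (dotC e u) (dotC e ustar) (dotC ustar u).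
lra.
Qed.

(** In the descent inequality the gap is nonnegative by [lagrangian_ge], and Young's inequality with
    [energy_ge] bounds the noise product by [a * V x u + a / 2 * sqnorm eta]. *)
Lemma energy_growth :
  V x' u' <= (1 + a) * V x u + (a / 2 + a ^+ 2) * sqnorm eta.
Proof.
have Xx' : X x' by case: hx'.
have := one_step_descent.
have := lagrangian_ge Xx'; rewrite -subr_ge0 => /(mulr_ge0 (ltW a0)).
have := ler_wpM2l (ltW a0) (energy_ge u Xx).
have := dot_young eta (x - xstar).
rewrite ler_norml => /andP[/(ler_wpM2l (ltW a0)) + _].
lra.
Qed.

End Step.
End OneStep.


(** * Independence of the noise and the past *)

Section LevelSets.
Context d (T : measurableType d) (R : realType).
Implicit Types (P : probability T R) (g Y : T -> R).

(** A floor is an integer, so it lies below [c] exactly when [Y t] lies below the ceiling of [c]. *)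
Lemma measurable_fun_floor Y : measurable_fun setT Y ->
  measurable_fun setT (fun t => (Num.floor (Y t))%:~R : R).
Proof.
move=> mY; apply: (measurability _ (RGenInftyO.measurableE R)) => //.
move=> _ [_ [c ->] <-]; rewrite setTI.
have -> : (fun t => (Num.floor (Y t))%:~R : R) @^-1` `]-oo, c[ =
    setT `&` Y @^-1` `]-oo, (Num.ceil c)%:~R[.
  rewrite setTI; apply/seteqP; split => t /=; rewrite !in_itv/=.
    by rewrite -ceil_gt_int floor_lt_int.
  by rewrite -floor_lt_int ceil_gt_int.
exact: mY.
Qed.

(* Replacing [Y] by its rounding [floor (m * Y) / m] changes the integral by at
   most [m^-1 * \int `|g|], and the rounded integral is a countable sum of
   integrals of [g] over level sets of [Y]. *)
Lemma integral_mul_level_eq0 P g Y :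
  P.-integrable setT (EFin \o g) -> measurable_fun setT Y ->
  P.-integrable setT (fun t => (g t * Y t)%:E) ->
  (forall a b, (\int[P]_(t in Y @^-1` `[a, b[) (g t)%:E = 0)%E) ->
  (\int[P]_t (g t * Y t)%:E = 0)%E.
Proof.
move=> ig mY igY g0.
have mg : measurable_fun setT g by apply/measurable_EFinP; case/integrableP: ig.
pose y n t : R := (Num.floor (Y t * n.+1%:R))%:~R / n.+1%:R.
have n0 n : 0 < n.+1%:R :> R by rewrite ltr0n.
have yY n t : `|Y t - y n t| <= n.+1%:R^-1.
  have /andP[lo] := floor_itv (Y t * n.+1%:R).
  rewrite rmorphD/= => hi; have -> : Y t - y n t =
      (Y t * n.+1%:R - (Num.floor (Y t * n.+1%:R))%:~R) / n.+1%:R.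
    by rewrite /y; field; rewrite gt_eqF.
  rewrite ger0_norm; last by rewrite divr_ge0// ?(ltW (n0 _)) ?subr_ge0.
  by rewrite ler_pdivrMr// mulVf ?gt_eqF//; lra.
have my n : measurable_fun setT (y n).
  apply: measurable_funM => //; apply: measurable_fun_floor.
  exact: measurable_funM.
have idiff n : P.-integrable setT (fun t => (g t * (Y t - y n t))%:E).
  apply: (le_integrable _ _ _ ig) => //.
    by apply/measurable_EFinP; apply: measurable_funM => //; exact: measurable_funB.
  move=> t _ /=; rewrite lee_fin normrM -[leRHS]mulr1 ler_wpM2l//.
  by apply: (le_trans (yY n t)); rewrite invf_le1// ler1n.
have igy n : P.-integrable setT (fun t => (g t * y n t)%:E).
  have := integrableB measurableT igY (idiff n); apply: eq_integrable => // t _.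
  by rewrite -EFinB; congr EFin; ring.
(* [pickle] enumerates the integer levels by natural numbers; an index that codes no integer gives
   the empty set. *)
pose F n i : set T := [set t | pickle (Num.floor (Y t * n.+1%:R)) = i].
have FE n i : F n i = set0 \/ exists z : int,
    (F n i = Y @^-1` `[z%:~R / n.+1%:R, (z + 1)%:~R / n.+1%:R[) /\
    forall t, F n i t -> y n t = z%:~R / n.+1%:R.
  have [[z zi]|nz] := pselect (exists z : int, pickle z = i); [right|left].
    have Fz t : F n i t <-> Num.floor (Y t * n.+1%:R) = z.
      by rewrite /F/= -zi; split => [/(pcan_inj pickleK)|->].
    exists z; split=> [|t /Fz <-//].
    apply/seteqP; split => t; rewrite /= in_itv/= ler_pdivrMr// ltr_pdivlMr//.
      by move=> /Fz <-; exact: floor_itv.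
    by move=> h; apply/Fz; exact: floor_def.
  by apply/seteqP; split=> // t Ft; apply: nz; exists (Num.floor (Y t * n.+1%:R)).
have mF n i : measurable (F n i).
  by have [->//|[z [-> _]]] := FE n i; rewrite -[X in measurable X]setTI; exact: mY.
have intF n i : (\int[P]_(t in F n i) (g t * y n t)%:E = 0)%E.
  have [->|[z [Fz yz]]] := FE n i; first by rewrite integral_set0.
  rewrite (eq_integral (fun t => ((z%:~R / n.+1%:R)%:E * (g t)%:E)%E)); last first.
    by move=> t; rewrite inE => /yz ->; rewrite -EFinM mulrC.
  rewrite integralZl//; last exact: integrableS ig.
  by rewrite Fz g0 mule0.
have inty n : (\int[P]_t (g t * y n t)%:E = 0)%E.
  have FT : \bigcup_i F n i = [set: T].
    by apply/seteqP; split => // t _; exists (pickle (Num.floor (Y t * n.+1%:R))).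
  rewrite -FT integral_bigcup//.
  - by rewrite eseries0.
  - by move=> i j _ _ [t []]; rewrite /F/= => -> ->.
  - by rewrite FT.
have mabs (h : T -> R) : measurable_fun setT h -> measurable_fun setT (fun t => `|(h t)%:E|%E).
  by move=> mh; apply: (measurableT_comp (@abse_measurable _ setT)); exact/measurable_EFinP.
have bound n : (`|\int[P]_t (g t * Y t)%:E| <= n.+1%:R^-1%:E * \int[P]_t `|(g t)%:E|)%E.
  have -> : (\int[P]_t (g t * Y t)%:E = \int[P]_t (g t * (Y t - y n t))%:E)%E.
    rewrite -[LHS]sube0 -(inty n) -integralB//.
    by apply: eq_integral => t _; rewrite -EFinB; congr EFin; ring.
  apply: (le_trans (le_abse_integral _ _ _)) => //.
    by case/integrableP: (idiff n).
  rewrite -ge0_integralZl//; last exact: mabs.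
  apply: ge0_le_integral => //.
  - by apply: mabs; apply/measurable_EFinP; case/integrableP: (idiff n).
  - by apply: measurable_funeM; exact: mabs.
  - by move=> t _; rewrite -EFinM lee_fin normrM mulrC ler_wpM2r.
have fin_g : (\int[P]_t `|(g t)%:E|)%E \is a fin_num.
  by rewrite ge0_fin_numE ?integral_ge0//; case/integrableP: ig.
apply/eqP; rewrite -abse_eq0; apply/eqP/le_anti; rewrite abse_ge0 andbT.
apply/lee_addgt0Pr => e e0; rewrite add0e.
set G := (\int[P]_t `|(g t)%:E|)%E in fin_g bound.
have G0 : 0 <= fine G by rewrite fine_ge0// integral_ge0.
pose n := Num.truncn (fine G / e).
apply: (le_trans (bound n)); rewrite -(fineK fin_g) -EFinM lee_fin.
rewrite mulrC ler_pdivrMr// mulrC -ler_pdivrMr// ltW//.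
exact: truncnS_gt.
Qed.

End LevelSets.


(** * Noise with zero mean against functions of its past *)

Section IndependentPast.
Context dT (T : measurableType dT) (R : realType) (P : probability T R).
Variables (p : nat) (Z : nat -> T -> 'cV[R]_p).
Hypotheses (mZ : forall k, random_vector (Z k)) (indZ : mutually_independent P Z).
Hypothesis iZ : forall k i, P.-integrable setT (fun t => (Z k t i 0)%:E).
Hypothesis Z0 : forall k i, (\int[P]_t (Z k t i 0)%:E = 0)%E.

(** The cylinder events of the first [m] vectors: a pi-system generating the history before time
    [m]. *)
Definition past m : set (set T) :=
  [set A | exists2 B : nat -> set (borel_cV R p), (forall k, measurable (B k)) &
           A = \bigcap_(k < m) Z k @^-1` B k].

Lemma setI_closed_past m : setI_closed (past m).
Proof.
move=> _ _ [B mB ->] [C mC ->]; exists (fun k => B k `&` C k).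
  by move=> k; exact: measurableI.
by rewrite -bigcapI; apply: eq_bigcapr => k _; rewrite preimage_setI.
Qed.

Lemma measurable_preimage_rv k (B : set (borel_cV R p)) : measurable B ->
  measurable (Z k @^-1` B).
Proof. by move=> mB; rewrite -[X in measurable X]setTI; exact: mZ. Qed.

Lemma measurable_past m : past m `<=` measurable.
Proof.
move=> _ [B mB ->]; apply: bigcap_measurableType.
by move=> k _; exact: measurable_preimage_rv.
Qed.

Lemma sub_pastS m : past m `<=` past m.+1.
Proof.
move=> _ [B mB ->]; exists (fun k => if (k < m)%N then B k else setT).
  by move=> k; case: ifP.
apply/seteqP; split => t h k /= km.
  by case: ifP => // km'; exact: h.
by have := h k (ltnW km); rewrite /= km.
Qed.

Lemma measurable_coord i : measurable_fun [set: borel_cV R p] (fun c => c i 0 : R).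
Proof.
apply: (measurability _ (RGenOpens.measurableE R)) => // _ [_ [a [b ->]] <-].
rewrite setTI; apply: sub_sigma_algebra.
by move/continuousP : (@coord_continuous R p 1 i 0); apply; exact: interval_open.
Qed.

Lemma past_preimage k m (B : set (borel_cV R p)) : (k < m)%N -> measurable B ->
  past m (Z k @^-1` B).
Proof.
move=> km mB; exists (fun j => if j == k then B else setT).
  by move=> j; case: ifP.
apply/seteqP; split => t h; last by have := h k km; rewrite /= eqxx.
by move=> j /= _; case: eqP => [->|].
Qed.

Lemma measurable_fun_past k m i : (k < m)%N ->
  measurable_fun [set: g_sigma_algebraType (past m)] (fun t => Z k t i 0 : R).
Proof.
move=> km _ B mB; rewrite setTI; apply: sub_sigma_algebra.
have -> : (fun t => Z k t i 0) @^-1` B = Z k @^-1` ((fun c : borel_cV R p => c i 0) @^-1` B).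
  by [].
apply: past_preimage => //; rewrite -[X in measurable X]setTI.
exact: measurable_coord.
Qed.

Lemma measurable_fun_rv k i : measurable_fun setT (fun t => Z k t i 0 : R).
Proof. by apply/measurable_EFinP; case/integrableP: (iZ k i). Qed.

(** Mutual independence is applied to the first [m.+1] indices and to the first [m]; [D] extends the
    events of [A] by [B] at index [m]. *)
Lemma probability_past m A (B : set (borel_cV R p)) : past m A -> measurable B ->
  (P (A `&` Z m @^-1` B) = P A * P (Z m @^-1` B))%E.
Proof.
move=> [C mC AE] mB.
pose D k := if (k < m)%N then C k else B.
have mD k : measurable (D k) by rewrite /D; case: ifP.
have DA : A = \bigcap_(k < m) Z k @^-1` D k.
  by rewrite AE; apply: eq_bigcapr => k /= km; rewrite /D km.
have iotaE n : [set` iota 0 n] = `I_n.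
  by apply/seteqP; split => k; rewrite /mkset mem_iota add0n.
have := indZ (iota_uniq 0 m.+1) (fun k _ => mD k).
have := indZ (iota_uniq 0 m) (fun k _ => mD k).
rewrite !iotaE -DA => ->.
rewrite -addn1 iotaD big_cat/= big_seq1 {3 4}/D ltnn add0n => <-.
congr (P _); rewrite DA; apply/seteqP; split => t.
  move=> [At Bt] k /=; rewrite addn1 ltnS leq_eqVlt => /orP[/eqP ->|km].
    by rewrite /D ltnn.
  exact: At.
move=> h; split; first by move=> k km; apply: h; rewrite /= addn1 ltnS ltnW.
by have := h m; rewrite /= addn1 /D ltnn; apply.
Qed.

(** The level-set lemma is used with the centred indicator of [A] as [g] and the noise coordinate as
    [Y]; the zero mean of the noise then removes the centring term. *)
Lemma integral_past_eq0 m i A : past m A -> (\int[P]_(t in A) (Z m t i 0)%:E = 0)%E.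
Proof.
move=> pA; have mA := measurable_past pA.
have PA : P A \is a fin_num by exact: fin_num_measure.
(* [1_A - P A] has zero integral over every event of the form [Z m i \in B]. *)
pose g t : R := \1_A t - fine (P A).
have icst : P.-integrable setT (EFin \o cst (fine (P A))).
  exact: finite_measure_integrable_cst.
have mg : measurable_fun setT g by apply: measurable_funB => //; exact: measurable_indic.
have iAZ : P.-integrable setT (fun t => (Z m t i 0 * \1_A t)%:E).
  apply: (le_integrable _ _ _ (iZ m i)) => //.
    apply/measurable_EFinP; apply: measurable_funM; first exact: measurable_fun_rv.
    exact: measurable_indic.
  move=> t _; rewrite lee_fin normrM ler_piMr// indicE.
  by case: (_ \in _); rewrite ?normr1 ?normr0.
have gE t : (g t * Z m t i 0)%:E =
    ((Z m t i 0 * \1_A t)%:E - (fine (P A))%:E * (Z m t i 0)%:E)%E.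
  by rewrite -EFinM -EFinB; congr EFin; rewrite /g; ring.
have icZ := integrableZl measurableT (fine (P A)) (iZ m i).
suff : (\int[P]_t (g t * Z m t i 0)%:E = 0)%E.
  rewrite (eq_integral _ _ (fun t _ => gE t)) (integralB measurableT iAZ icZ).
  rewrite integralZl// Z0 mule0 sube0 => <-.
  rewrite [LHS]integral_mkcond; apply: eq_integral => t _.
  by rewrite patchE indicE; case: (_ \in _); rewrite ?mulr1 ?mulr0.
apply: integral_mul_level_eq0.
- apply: eq_integrable (integrableB measurableT (integrable_indic P mA) icst) => //.
- exact: measurable_fun_rv.
- by apply: eq_integrable (integrableB measurableT iAZ icZ) => // t _; rewrite gE.
- move=> a b.
  have mB : measurable ((fun c : borel_cV R p => c i 0 : R) @^-1` `[a, b[).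
    by rewrite -[X in measurable X]setTI; apply: measurable_coord.
  set B := _ @^-1` _ in mB.
  have mZB := measurable_preimage_rv m mB.
  rewrite -[X in (\int[_]_(t in X) _)%E]/(Z m @^-1` B).
  have -> : (\int[P]_(t in Z m @^-1` B) (g t)%:E =
             \int[P]_(t in Z m @^-1` B) ((\1_A t)%:E - cst (fine (P A))%:E t))%E.
    by apply: eq_integral => t _; rewrite -EFinB.
  rewrite integralB//; last 2 first.
  + exact: integrableS (integrable_indic P mA).
  + exact: integrableS icst.
  rewrite integral_indic// integral_cst// fineK// [X in (X - _)%E](probability_past pA mB).
  by apply: subee; rewrite fin_numM// fin_num_measure.
Qed.

(** Dynkin's pi-lambda argument: the zero mean handles complements, and countable additivity handles
    disjoint unions. *)
Lemma integral_g_past_eq0 m i A : <<s past m>> A ->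
  measurable A /\ (\int[P]_(t in A) (Z m t i 0)%:E = 0)%E.
Proof.
rewrite -setI_closed_g_dynkin_g_sigma_algebra; last exact: setI_closed_past.
suff : <<d past m>> `<=`
  [set B : set T | measurable B /\ (\int[P]_(t in B) (Z m t i 0)%:E = 0)%E] by exact.
apply: smallest_sub; last first.
  by move=> B pB; split; [exact: measurable_past pB|exact: integral_past_eq0].
split.
- by split=> //; exact: Z0.
- move=> B [mB B0]; split; first exact: measurableC.
  have := Z0 m i; rewrite -(setUv B) integral_setU//.
  + by rewrite B0 add0e.
  + exact: measurableC.
  + by rewrite setUv; apply/measurable_EFinP; exact: measurable_fun_rv.
  + by rewrite disj_set2E setICr eqxx.
- move=> F tF hF; split; first by apply: bigcup_measurable => k _; case: (hF k).
  rewrite integral_bigcup//.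
  + by rewrite eseries0// => k _ _; case: (hF k).
  + by move=> k; case: (hF k).
  + apply: integrableS (iZ m i) => //.
    by apply: bigcup_measurable => k _; case: (hF k).
Qed.

(** The level-set lemma again with the roles exchanged: [g] is the noise coordinate, and the level
    sets of [Y] belong to the history. *)
Lemma integral_mul_past_eq0 m i (Y : T -> R) :
  measurable_fun [set: g_sigma_algebraType (past m)] Y ->
  P.-integrable setT (fun t => (Z m t i 0 * Y t)%:E) ->
  (\int[P]_t (Z m t i 0 * Y t)%:E = 0)%E.
Proof.
move=> mY iZY; apply: integral_mul_level_eq0 => //; first exact: iZ.
  by move=> _ B mB; have [] := integral_g_past_eq0 i (mY measurableT B mB).
move=> a b; have := mY measurableT `[a, b[%classic (measurable_itv _).
by rewrite setTI => /(integral_g_past_eq0 i)[].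
Qed.

End IndependentPast.


(** * Measurability of vector-valued maps *)

Section CoordMeasurable.
Context d (T : measurableType d) (R : realType).

(** The sigma-algebra on the domain stays a parameter, so that it can be either that of the whole
    space or a history. *)
Definition coord_measurable p (Y : T -> 'cV[R]_p) :=
  forall i, measurable_fun setT (fun t => Y t i 0).

(* The hypothesis makes [z] a continuous function of [Y] on the range of [Y]:
   [z < c] is a countable union of preimages under [Y] of cubes. *)
Lemma measurable_fun_dependence p (Y : T -> 'cV[R]_p) (z : T -> R) :
  coord_measurable Y ->
  (forall t e, 0 < e -> exists2 delta, 0 < delta &
     forall t', (forall i, `|Y t' i 0 - Y t i 0| < delta) -> `|z t' - z t| < e) ->
  measurable_fun setT z.
Proof.
move=> mY dep; apply: (measurability _ (RGenInftyO.measurableE R)) => //.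
move=> _ [_ [c ->] <-]; rewrite setTI.
(* [C nv] is the preimage under [Y] of the cube with side [nv.1.+1%:R^-1] and integer corner [nv.2]
   after rescaling. [F] keeps the cubes whose preimage lies in [z < c]; there are countably many. *)
pose C (nv : nat * {ffun 'I_p -> int}) : set T :=
  \bigcap_(i in [set: 'I_p]) (fun t => (Num.floor (Y t i 0 * nv.1.+1%:R))%:~R : R) @^-1`
    [set (nv.2 i)%:~R].
pose F nv := if `[< C nv `<=` z @^-1` `]-oo, c[ >] then C nv else set0.
have -> : z @^-1` `]-oo, c[ = \bigcup_nv F nv.
  apply/seteqP; split => [t|t [nv _]]; last by rewrite /F; case: asboolP => // + Ct; exact.
  rewrite /= in_itv/= -subr_gt0 => /(dep t)[delta delta0 zt].
  pose n := Num.truncn delta^-1.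
  have n0 : 0 < n.+1%:R :> R by rewrite ltr0n.
  exists (n, [ffun i => Num.floor (Y t i 0 * n.+1%:R)]) => //.
  rewrite /F; case: asboolP => [_ i _|]; first by rewrite /= ffunE.
  case=> t' Ct'; rewrite /= in_itv/=.
  suff /zt : forall i, `|Y t' i 0 - Y t i 0| < delta by rewrite ltr_norml; lra.
  move=> i; have := Ct' i I; rewrite /= ffunE => /intr_inj fl.
  have /andP[] := floor_itv (Y t' i 0 * n.+1%:R).
  have /andP[] := floor_itv (Y t i 0 * n.+1%:R).
  rewrite fl rmorphD/= => lo hi lo' hi'.
  have ndelta : 1 < n.+1%:R * delta.
    by rewrite -ltr_pdivrMr// div1r; exact: truncnS_gt.
  by rewrite -(ltr_pM2l n0) -[X in X * `|_|]ger0_norm ?ltW// -normrM ltr_norml; nra.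
apply: countable_bigcupT_measurable; first exact: countableP.
move=> nv; rewrite /F; case: asboolP => // _.
apply: fin_bigcap_measurable; first exact: finite_finset.
move=> i _; rewrite -[X in measurable X]setTI.
by apply: measurable_fun_floor => //; exact: measurable_funM.
Qed.

Section Operations.
Variable p : nat.
Implicit Types Y Z : T -> 'cV[R]_p.

Lemma coord_measurable_cst (c : 'cV[R]_p) : coord_measurable (fun=> c).
Proof. by move=> i; exact: measurable_cst. Qed.

Lemma coord_measurableD Y Z : coord_measurable Y -> coord_measurable Z ->
  coord_measurable (fun t => Y t + Z t).
Proof.
move=> mY mZ i; under eq_fun do rewrite mxE.
exact: measurable_funD.
Qed.

Lemma coord_measurableZ a Y : coord_measurable Y -> coord_measurable (fun t => a *: Y t).
Proof.
move=> mY i; under eq_fun do rewrite mxE.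
exact: measurable_funM.
Qed.

Lemma coord_measurableB Y Z : coord_measurable Y -> coord_measurable Z ->
  coord_measurable (fun t => Y t - Z t).
Proof.
move=> mY mZ; apply: coord_measurableD => //.
by under eq_fun do rewrite -scaleN1r; exact: coord_measurableZ.
Qed.

Lemma coord_measurable_mulmx q (A : 'M[R]_(q, p)) Y : coord_measurable Y ->
  coord_measurable (fun t => A *m Y t).
Proof.
move=> mY i; under eq_fun do rewrite mxE.
by apply: measurable_sum => j; exact: measurable_funM.
Qed.

Lemma measurable_sqnorm Y : coord_measurable Y -> measurable_fun setT (fun t => sqnorm (Y t)).
Proof.
move=> mY; under eq_fun do rewrite sqnormE.
by apply: measurable_sum => j; exact: measurable_funX.
Qed.

(** All values of [Y] lie in [X], so continuity within [X] gives the dependence required of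
    [g (Y t)] on [Y t]. *)
Lemma coord_measurable_within_continuous (X : set 'cV[R]_p) (g : 'cV[R]_p -> 'cV[R]_p) Y :
  {within X, continuous g} -> (forall t, X (Y t)) -> coord_measurable Y ->
  coord_measurable (fun t => g (Y t)).
Proof.
move=> /subspace_continuousP cg XY mY i; apply: (measurable_fun_dependence mY) => t e e0.
have /cvg_ball/(_ e e0) := cg _ (XY t).
rewrite /within/= => /nbhs_ballP[delta delta0 sub].
exists delta => // t' Yt'.
have [||_ /(_ i 0)] := sub (Y t').
- split=> // j k; rewrite (ord1 k) -ball_normE/= distrC; exact: Yt'.
- exact: XY.
by rewrite -ball_normE/= distrC.
Qed.

Lemma coord_measurable_nonexpansive Y Z : coord_measurable Y ->
  (forall t t', sqnorm (Z t' - Z t) <= sqnorm (Y t' - Y t)) -> coord_measurable Z.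
Proof.
move=> mY YZ i; apply: (measurable_fun_dependence mY) => t e e0.
(* With this tolerance the [p] squares add up to less than [e ^+ 2], also when [p = 0]. *)
exists (e / p.+1%:R) => [|t' Yt']; first by rewrite divr_gt0.
rewrite -(ltr_pXn2r (n := 2)) ?nnegrE ?(ltW e0)// real_normK ?num_real//.
have := le_sqr_sqnorm (Z t' - Z t) i; rewrite !mxE => /le_lt_trans; apply.
apply: (le_lt_trans (YZ t t')); rewrite sqnormE.
apply: (@le_lt_trans _ _ (\sum_(j < p) (e / p.+1%:R) ^+ 2)).
  apply: ler_sum => j _; rewrite !mxE -real_normK ?num_real//.
  by rewrite ler_pXn2r ?nnegrE ?divr_ge0 ?(ltW e0)//; exact: ltW (Yt' j).
rewrite sumr_const card_ord -[ltLHS]mulr_natl exprMn mulrCA gtr_pMr ?exprn_gt0//.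
rewrite exprVn ltr_pdivrMr ?exprn_gt0// mul1r -natrX ltr_nat.
by rewrite (leq_trans (ltnSn p))// leq_pmulr.
Qed.

End Operations.
End CoordMeasurable.


(** * Convergence *)

Section Jensen.
Variables (R : realType) (d : nat) (X : set 'cV[R]_d) (h : 'cV[R]_d -> R).
Hypotheses (cX : convex_set X) (ch : convex_function X h).

Lemma convex_function_add_dot (c : 'cV[R]_d) : convex_function X (fun z => h z + dot c z).
Proof.
move=> t x y Xx Xy; have := ch t Xx Xy; rewrite !convRE => hle.
have -> : dot c (conv t x y) = t%:num * dot c x + unstable.onem t%:num * dot c y.
  by rewrite /conv/= dotDr !dotZr.
by lra.
Qed.

(** Induction on [K]: the new mean lies on the segment from the old mean to the new point, at
    parameter [b / (L + b)]. *)
Lemma jensen_weighted (a : nat -> R) (z : nat -> 'cV[R]_d) K :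
  (forall k, (1 <= k)%N -> 0 < a k) -> (forall k, (1 <= k)%N -> X (z k)) ->
  (1 <= K)%N ->
  let L := \sum_(1 <= k < K.+1) a k in
  let zbar := L^-1 *: (\sum_(1 <= k < K.+1) a k *: z k) in
  [/\ 0 < L, X zbar & L * h zbar <= \sum_(1 <= k < K.+1) a k * h (z k)].
Proof.
move=> a0 Xz; case: K => // K _ /=; elim: K => [|K [L0 Xb IH]].
  have a1 := a0 1%N isT; rewrite !big_nat1 scalerA mulVf ?(gt_eqF a1)// scale1r.
  by split=> //; exact: Xz.
rewrite !(big_nat_recr K.+2)//=.
set L := \sum_(_ <= _ < _) _ in L0 Xb IH *; set S := \sum_(_ <= _ < _) _ in Xb IH *.
set b := a K.+2; have b0 : 0 < b by exact: a0.
have Lb : 0 < L + b by rewrite addr_gt0.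
have -> : (L + b)^-1 *: (S + b *: z K.+2) =
    L^-1 *: S + (b / (L + b)) *: (z K.+2 - L^-1 *: S).
  rewrite scalerDr scalerBr !scalerA (addrC (_ *: z _)) addrA -scalerBl.
  congr (_ *: _ + _ *: _); last by rewrite mulrC.
  by field; rewrite !gt_eqF.
have s01 : 0 <= b / (L + b) <= 1.
  by rewrite divr_ge0 ?(ltW b0) ?(ltW Lb)//= ler_pdivrMr// mul1r lerDr ltW.
split=> //; first exact: (convex_set_segment cX Xb (Xz K.+2 isT) s01).
apply: (@le_trans _ _ (L * h (L^-1 *: S) + b * h (z K.+2))); last by rewrite lerD2r.
have := convex_function_segment ch Xb (Xz K.+2 isT) s01.
rewrite -(ler_pM2l Lb) => /le_trans; apply; rewrite le_eqVlt; apply/orP; left.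
by apply/eqP; field; rewrite gt_eqF.
Qed.

End Jensen.

(* The integral of a nonnegative function is a supremum over the simple
   functions below it, so measurability of [f] and [g] plays no role. *)
Lemma le_integral_pointwise d (T : measurableType d) (R : realType)
    (mu : {measure set T -> \bar R}) (f g : T -> \bar R) : (forall t, f t <= g t)%E ->
  (\int[mu]_t f t <= \int[mu]_t g t)%E.
Proof.
move=> fg; rewrite /integral !patch_setT; apply: leeB; apply: le_ereal_sup.
  move=> _ [h hf <-]; exists h => // t; apply: (le_trans (hf t)).
  by rewrite !funeposE; exact: le_max2.
move=> _ [h hf <-]; exists h => // t; apply: (le_trans (hf t)).
by rewrite !funenegE; apply: le_max2 => //; rewrite leeN2.
Qed.


Lemma coord_measurable_sub_sigma d (T : measurableType d) (R : realType) p
    (G G' : set (set T)) (Y : T -> 'cV[R]_p) : G `<=` G' ->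
  coord_measurable (Y : g_sigma_algebraType G -> _) ->
  coord_measurable (Y : g_sigma_algebraType G' -> _).
Proof.
move=> GG' mY i _ B mB; have := mY i measurableT B mB.
apply: smallest_sub; first exact: smallest_sigma_algebra.
exact: subset_trans GG' (@sub_sigma_algebra _ setT G').
Qed.

Lemma coord_measurable_g_sigma d (T : measurableType d) (R : realType) p
    (G : set (set T)) (Y : T -> 'cV[R]_p) : G `<=` measurable ->
  coord_measurable (Y : g_sigma_algebraType G -> _) -> coord_measurable Y.
Proof.
move=> Gm mY i _ B mB; have := mY i measurableT B mB.
apply: smallest_sub => //; exact: sigma_algebra_measurable.
Qed.

(** * The random iterates: adaptedness, integrability and the expected gap *)

Section StochasticProcess.
Variables (R : realType) (p q : nat) (X : set 'cV[R]_p).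
Variables (f psi : 'cV[R]_p -> R) (gradf gradpsi : 'cV[R]_p -> 'cV[R]_p).
Variables (El : 'M[R]_(p, q)) (Lr : 'M[R]_p) (beta lambda : R).
Variables (xstar : 'cV[R]_p) (ustar : 'cV[R]_q).
Hypotheses (cX : convex_set X) (hgradf : C1_gradient X f gradf)
  (hgradpsi : C1_gradient X psi gradpsi).
Hypotheses (cvxf : convex_function X f)
  (smf : convex_function X (fun z => beta / 2 * sqnorm z - f z))
  (scpsi : convex_function X (fun z => psi z - 2^-1 * sqnorm z)).
Hypotheses (symL : Lr^T = Lr) (L_ge0 : forall y, 0 <= dot (Lr *m y) y)
  (L_le : forall y, dot (Lr *m y) y <= lambda * sqnorm y).
Hypotheses (Exs : El^T *m xstar = 0) (Lxs : Lr *m xstar = 0) (Xxs : X xstar)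
  (opt : normal_cone X xstar (- (El *m ustar) - gradf xstar)).
Let V := energy psi gradpsi xstar ustar.
Let lag x := lagrangian f El x ustar.

Context dT (T : measurableType dT) (P : probability T R).
Variables (alpha : nat -> R) (sigma : R) (eta : nat -> T -> 'cV[R]_p).
Hypotheses (alpha_gt0 : forall k, (1 <= k)%N -> 0 < alpha k)
  (alpha_le : forall k, (1 <= k)%N -> alpha k * (beta + lambda) <= 2^-1)
  (alphaE : forall k, (1 <= k)%N ->
     forall y, alpha k * sqnorm (El^T *m y) <= dot (Lr *m y) y).
Hypotheses (meta : forall k, (1 <= k)%N -> random_vector (eta k))
  (ind_eta : mutually_independent P (fun k => eta k.+1))
  (eta0 : forall k, (1 <= k)%N -> forall i, ('E_P[fun t => eta k t i 0%R] = 0)%E)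
  (var_eta : forall k, (1 <= k)%N ->
     ('E_P[fun t => sqnorm (eta k t)] <= (sigma ^+ 2)%:E)%E).
Variables (x1 : 'cV[R]_p) (u1 : 'cV[R]_q).
Variables (x : nat -> T -> 'cV[R]_p) (u : nat -> T -> 'cV[R]_q).
Hypotheses (Xx1 : X x1) (x1E : forall t, x 1%N t = x1) (u1E : forall t, u 1%N t = u1).
Hypothesis hx : forall k, (1 <= k)%N -> forall t, is_argmin X
  (fun y => alpha k * dot (Lr *m x k t + El *m u k t + gradf (x k t) + eta k t) y +
            bregman psi gradpsi y (x k t)) (x k.+1 t).
Hypothesis hu : forall k, (1 <= k)%N -> forall t,
  u k.+1 t = u k t + alpha k *: (El^T *m x k.+1 t).

(** With this shift [x k.+1] depends on the first [k] vectors of [Z] only, and [Z k] is the noise it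
    meets next. *)
Let Z k := eta k.+1.

Lemma iterate_feasible k t : (1 <= k)%N -> X (x k t).
Proof. by case: k => [//|[_|k _]]; [rewrite x1E|case: (@hx k.+1 isT t)]. Qed.

(** By induction the input of the mirror step is adapted, the gradients being continuous within [X];
    nonexpansiveness transfers this to the minimizer. *)
Lemma iterate_adapted k :
  coord_measurable (x k.+1 : g_sigma_algebraType (past Z k) -> _) /\
  coord_measurable (u k.+1 : g_sigma_algebraType (past Z k) -> _).
Proof.
elim: k => [|k [/coord_measurable_sub_sigma mx /coord_measurable_sub_sigma mu]].
  rewrite (_ : x 1%N = fun=> x1); last exact/funext.
  by rewrite (_ : u 1%N = fun=> u1); [split; exact: coord_measurable_cst|exact/funext].
have {}mx := mx _ (@sub_pastS _ T R p Z k).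
have {}mu := mu _ (@sub_pastS _ T R p Z k).
have mZ : coord_measurable (Z k : g_sigma_algebraType (past Z k.+1) -> _).
  by move=> i; exact: measurable_fun_past.
have Xx t : X (x k.+1 t) by exact: iterate_feasible.
have mx' : coord_measurable (x k.+2 : g_sigma_algebraType (past Z k.+1) -> _).
  apply: (@coord_measurable_nonexpansive _ (g_sigma_algebraType (past Z k.+1)) _ _
    (fun t : T => alpha k.+1 *:
    (Lr *m x k.+1 t + El *m u k.+1 t + gradf (x k.+1 t) + Z k t) - gradpsi (x k.+1 t))).
    apply: coord_measurableB.
      apply: coord_measurableZ; apply: coord_measurableD => //.
      apply: coord_measurableD.
        by apply: coord_measurableD; exact: coord_measurable_mulmx.
      exact: (coord_measurable_within_continuous hgradf.2).
    exact: (coord_measurable_within_continuous hgradpsi.2).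
  move=> t t'; apply: (mirror_step_nonexpansive cX hgradpsi scpsi); exact: hx.
split=> //; rewrite (_ : u k.+2 = fun t => u k.+1 t + alpha k.+1 *: (El^T *m x k.+2 t)).
  apply: coord_measurableD => //; apply: coord_measurableZ.
  exact: coord_measurable_mulmx.
by apply/funext => t; rewrite hu.
Qed.

Let mZ k : random_vector (Z k) := meta (ltn0Sn k).

Lemma coord_measurable_noise k : coord_measurable (Z k).
Proof.
move=> i _ B mB; rewrite setTI.
have mC := @measurable_coord R p i measurableT B mB; rewrite setTI in mC.
exact: measurable_preimage_rv mZ k _ mC.
Qed.

Lemma integrable_sqnorm_noise k : P.-integrable setT (fun t => (sqnorm (Z k t))%:E).
Proof.
apply/integrableP; split.
  by apply/measurable_EFinP; exact: measurable_sqnorm (coord_measurable_noise k).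
have := var_eta (ltn0Sn k); rewrite unlock /= => vk.
apply: (@le_lt_trans _ _ (sigma ^+ 2)%:E); last exact: ltry.
apply: le_trans vk; rewrite le_eqVlt; apply/orP; left; apply/eqP.
by apply: eq_integral => t _ /=; rewrite ger0_norm ?sqnorm_ge0.
Qed.

(** The second moment dominates the first, since an absolute value is at most one plus its
    square. *)
Lemma integrable_noise k i : P.-integrable setT (fun t => (Z k t i 0)%:E).
Proof.
have i1 : P.-integrable setT (EFin \o cst (1 : R)) by exact: finite_measure_integrable_cst.
apply: (le_integrable _ _ _ (integrableD measurableT i1 (integrable_sqnorm_noise k))) => //.
  by apply/measurable_EFinP; exact: coord_measurable_noise.
move=> t _ /=; rewrite lee_fin [leRHS]ger0_norm ?addr_ge0 ?sqnorm_ge0//.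
have := le_sqr_sqnorm (Z k t) i; rewrite -real_normK ?num_real//.
set a := `|_|; have := sqr_ge0 (a - 1); nra.
Qed.

Let one_step k t := one_step_descent ustar cX hgradf hgradpsi cvxf smf scpsi symL L_ge0 L_le
  Exs Lxs Xxs (alpha_gt0 (ltn0Sn k)) (alpha_le (ltn0Sn k)) (alphaE (ltn0Sn k))
  (iterate_feasible t (ltn0Sn k)) (hx (ltn0Sn k) t) (hu (ltn0Sn k) t).

Let growth k t := energy_growth cX hgradf hgradpsi cvxf smf scpsi symL L_ge0 L_le
  Exs Lxs Xxs opt (alpha_gt0 (ltn0Sn k)) (alpha_le (ltn0Sn k)) (alphaE (ltn0Sn k))
  (iterate_feasible t (ltn0Sn k)) (hx (ltn0Sn k) t) (hu (ltn0Sn k) t).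

(** Iterating [energy_growth] produces an integrable majorant, so the measurability of the energy
    itself is never at issue. *)
Lemma energy_dominated k : exists2 W : T -> R, P.-integrable setT (EFin \o W) &
  forall t, V (x k.+1 t) (u k.+1 t) <= W t.
Proof.
elim: k => [|k [W iW VW]].
  exists (cst (V x1 u1)); first exact: finite_measure_integrable_cst.
  by move=> t; rewrite x1E u1E.
exists (fun t => (1 + alpha k.+1) * W t +
                 (alpha k.+1 / 2 + alpha k.+1 ^+ 2) * sqnorm (Z k t)).
  exact: (integrableD measurableT (integrableZl measurableT (1 + alpha k.+1) iW)
    (integrableZl measurableT (alpha k.+1 / 2 + alpha k.+1 ^+ 2) (integrable_sqnorm_noise k))).
move=> t; apply: (le_trans (growth k t)); rewrite lerD2r ler_wpM2l//.
by rewrite addr_ge0// ltW// alpha_gt0.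
Qed.

Let cross k t := dot (Z k t) (x k.+1 t - xstar).

(** Each coordinate product is dominated by [W] plus the squared noise norm, through [energy_ge].
    Its second factor is measurable for the history, so its integral vanishes. *)
Lemma cross_term k : P.-integrable setT (EFin \o cross k) /\
  (\int[P]_t (cross k t)%:E = 0)%E.
Proof.
have [W iW VW] := energy_dominated k.
have my : coord_measurable ((fun t => x k.+1 t - xstar) : g_sigma_algebraType (past Z k) -> _).
  by apply: coord_measurableB; [case: (iterate_adapted k)|exact: coord_measurable_cst].
have my' := coord_measurable_g_sigma (measurable_past mZ (m := k)) my.
have icr i : P.-integrable setT (fun t => (Z k t i 0 * (x k.+1 t - xstar) i 0)%:E).
  apply: (le_integrable _ _ _ (integrableD measurableT iW (integrable_sqnorm_noise k))) => //.
    apply/measurable_EFinP; apply: measurable_funM; first exact: coord_measurable_noise.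
    exact: my'.
  move=> t _ /=; rewrite lee_fin; apply: le_trans (ler_norm _).
  have := le_sqr_sqnorm (Z k t) i; have := le_sqr_sqnorm (x k.+1 t - xstar) i.
  have := energy_ge ustar cX hgradpsi scpsi Xxs (u k.+1 t) (iterate_feasible t (ltn0Sn k)).
  move/le_trans/(_ (VW t)); set a := Z k t i 0; set b := (x k.+1 t - xstar) i 0 => h1 h2 h3.
  have := sqr_ge0 (a - b); have := sqr_ge0 (a + b); have := sqnorm_ge0 (Z k t).
  by rewrite ler_norml => ? ? ?; apply/andP; split; nra.
have crE t : (cross k t)%:E = (\sum_i (Z k t i 0 * (x k.+1 t - xstar) i 0)%:E)%E.
  by rewrite sumEFin /cross dotE.
split.
  apply: eq_integrable (integrable_sum measurableT (index_enum _) (P := xpredT)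
    (fun i _ => icr i)) => // t _.
  by rewrite /= crE.
rewrite (eq_integral _ _ (fun t _ => crE t)) integral_sum// big1// => i _.
apply: (integral_mul_past_eq0 mZ ind_eta integrable_noise) => //.
by move=> j i'; have := eta0 (ltn0Sn j) i'; rewrite unlock.
Qed.

(** The telescoped right-hand side without the final energy. Because [Z] is shifted, [cross k.-1]
    pairs [eta k] with [x k]. *)
Let bound K t := V x1 u1 + \sum_(1 <= k < K.+1)
  (alpha k ^+ 2 * sqnorm (eta k t) - alpha k * cross k.-1 t).

Lemma integral_bound K : P.-integrable setT (EFin \o bound K) /\
  (\int[P]_t (bound K t)%:E <=
    (V x1 u1 + sigma ^+ 2 * \sum_(1 <= k < K.+1) alpha k ^+ 2)%:E)%E.
Proof.
elim: K => [|K [iB IH]].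
  rewrite /bound; under eq_fun do rewrite big_geq// addr0.
  rewrite big_geq// mulr0 addr0; split; first exact: finite_measure_integrable_cst.
  under eq_integral do rewrite big_geq// addr0.
  by rewrite integral_cst// [X in (_ * X)%E]probability_setT mule1.
have bE t : (bound K.+1 t)%:E = ((bound K t)%:E +
    ((alpha K.+1 ^+ 2)%:E * (sqnorm (Z K t))%:E - (alpha K.+1)%:E * (cross K t)%:E))%E.
  by rewrite /bound big_nat_recr//= addrA.
have [iC C0] := cross_term K.
have iS := integrable_sqnorm_noise K.
have i1 := integrableZl measurableT (alpha K.+1 ^+ 2) iS.
have i2 := integrableZl measurableT (alpha K.+1) iC.
have i3 := integrableB measurableT i1 i2.
split; first by apply: eq_integrable (integrableD measurableT iB i3) => // t _; rewrite /= bE.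
rewrite (eq_integral _ _ (fun t _ => bE t)) (integralD measurableT iB i3).
rewrite (integralB measurableT i1 i2) !integralZl// C0 mule0 sube0.
rewrite big_nat_recr//= mulrDr addrA EFinD; apply: leeD => //.
rewrite (mulrC (sigma ^+ 2)) [X in (_ <= X)%E]EFinM; apply: lee_wpmul2l.
  by rewrite lee_fin sqr_ge0.
by have := var_eta (ltn0Sn K); rewrite unlock.
Qed.

Lemma telescoped_descent K t :
  \sum_(1 <= k < K.+1) alpha k * (lag (x k.+1 t) - lag xstar) <=
  bound K t - V (x K.+1 t) (u K.+1 t).
Proof.
elim: K => [|K IH]; first by rewrite /bound !big_geq// addr0 x1E u1E subrr.
rewrite /bound !(big_nat_recr K.+1)//=.
apply: (le_trans (lerD IH (one_step K t))); rewrite /bound /cross /Z /V; lra.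
Qed.

Lemma expected_gap_bound K : (1 <= K)%N ->
  let xbar := fun t => (\sum_(1 <= k < K.+1) alpha k)^-1 *:
                         (\sum_(1 <= k < K.+1) alpha k *: x k.+1 t) in
  (('E_P[fun t => lag (xbar t)] - (lag xstar)%:E
    <= ((V x1 u1 + sigma ^+ 2 * \sum_(1 <= k < K.+1) alpha k ^+ 2)
        / \sum_(1 <= k < K.+1) alpha k)%:E)%E : Prop).
Proof.
move=> K1 xbar; set L := \sum_(_ <= _ < _) alpha _.
have clag : convex_function X lag := convex_function_add_dot cvxf (El *m ustar).
have jen t := jensen_weighted cX clag alpha_gt0
  (fun k _ => iterate_feasible t (ltn0Sn k)) K1.
have L0 : 0 < L by have [] := jen point.
(* Pathwise bound: Jensen's inequality, then telescoping, with the final energy dropped because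
   [energy_ge] makes it nonnegative. *)
have gap t : lag (xbar t) <= lag xstar + L^-1 * bound K t.
  have [_ Xb] := jen t; rewrite -/L -/(xbar t) => hb.
  have := telescoped_descent K t; have := sqnorm_ge0 (x K.+1 t - xstar).
  have := energy_ge ustar cX hgradpsi scpsi Xxs (u K.+1 t) (iterate_feasible t (ltn0Sn K)).
  rewrite -/V; under eq_bigr do rewrite mulrBr.
  rewrite sumrB -mulr_suml -/L => h1 h2 h3.
  by rewrite -lerBlDl ler_pdivlMl//; lra.
have [iB Bb] := integral_bound K.
have icst : P.-integrable setT (EFin \o cst (lag xstar)).
  exact: finite_measure_integrable_cst.
have iLB := integrableZl measurableT L^-1 iB.
rewrite unlock leeBlDl//.
apply: (@le_trans _ _ (\int[P]_t ((lag xstar)%:E + L^-1%:E * (bound K t)%:E))%E).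
  by apply: le_integral_pointwise => t; rewrite lee_fin.
rewrite (integralD measurableT icst iLB).
rewrite [X in (X + _)%E](integral_cst P measurableT (lag xstar)%:E).
rewrite [X in (_ * X + _)%E]probability_setT mule1.
rewrite integralZl// leeD2l// (mulrC _ L^-1) EFinM.
by apply: lee_wpmul2l => //; rewrite lee_fin invr_ge0 ltW.
Qed.

End StochasticProcess.

(** * Specialization to the distributed problem on the graph *)

Unset Implicit Arguments.
Set Strict Implicit.
Set Printing Implicit Defensive.

Theorem theorem2 (R : realType)
    (N : nat) (E : {set {set 'I_N}}) (hd tl : {set 'I_N} -> 'I_N)
    (hgraph : undirected_graph E) (hedge : (0 < #|E|)%N)
    (hconn : connected_graph E) (horient : orientation E hd tl)
    (l r : 'rV[R]_#|E|)
    (hl : forall j, 0 < l 0 j) (hr : forall j, 0 < r 0 j)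
    (n : nat) (X0 : set 'cV[R]_n)
    (hX0closed : closed X0) (hX0convex : convex_set X0)
    (psi0 : 'cV[R]_n -> R)
    (hpsi_proper : proper_function X0 psi0)
    (hpsi_closed : closed_function X0 psi0)
    (hpsi_C1 : continuously_differentiable X0 psi0)
    (hpsi_sc : strongly_convex1 X0 psi0)
    (fi : 'I_N -> 'cV[R]_n -> R) (beta : R) (hbeta : 0 <= beta)
    (hf_C1 : forall i, continuously_differentiable X0 (fi i))
    (hf_convex : forall i, convex_function X0 (fi i))
    (hf_smooth : forall i, smooth X0 beta (fi i))
    (gradf gradpsi : 'cV[R]_(N * n) -> 'cV[R]_(N * n)) (gamma lambda : R) :
  let El := weighted_incidence hd tl n l in
  let Lr := weighted_laplacian hd tl n r in
  let X := block_power (N := N) X0 in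
  let f := separable_sum fi in
  let psi := separable_sum (fun _ : 'I_N => psi0) in
  forall
    (hgradf : C1_gradient X f gradf)
    (hgradpsi : C1_gradient X psi gradpsi)
    (hgamma : is_maximum [set a : R | forall j, a * l 0 j <= r 0 j] (1 / gamma))
    (hlambda : is_maximum [set mu : R | eigenvalue Lr mu] lambda)
    (xstar : 'cV[R]_(N * n)) (ustar : 'cV[R]_(#|E| * n))
    (hstar_feas : El^T *m xstar = 0) (hstar_X : X xstar)
    (hstar_opt : normal_cone X xstar (- (El *m ustar) - gradf xstar))
    (d : measure_display) (T : measurableType d) (P : probability T R)
    (alpha : nat -> R)
    (halpha : forall k, (1 <= k)%N ->
       0 < alpha k <= Num.min (1 / (2 * (beta + lambda))) (1 / gamma))
    (sigma : R) (eta : nat -> T -> 'cV[R]_(N * n))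
    (heta_meas : forall k, (1 <= k)%N -> random_vector (eta k))
    (heta_indep : mutually_independent P (fun k => eta k.+1))
    (heta_mean : forall k, (1 <= k)%N ->
       forall i, ('E_P[fun t => eta k t i 0%R] = 0)%E)
    (heta_var : forall k, (1 <= k)%N ->
       ('E_P[fun t => sqnorm (eta k t)] <= (sigma ^+ 2)%:E)%E)
    (x1 : 'cV[R]_(N * n)) (u1 : 'cV[R]_(#|E| * n)) (hx1 : X x1)
    (x w : nat -> T -> 'cV[R]_(N * n)) (u : nat -> T -> 'cV[R]_(#|E| * n))
    (hx_init : forall t, x 1%N t = x1) (hu_init : forall t, u 1%N t = u1)
    (hw : forall k, (1 <= k)%N -> forall t,
       w k t = Lr *m x k t + El *m u k t + gradf (x k t) + eta k t)
    (hx : forall k, (1 <= k)%N -> forall t,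
       is_argmin X
         (fun y => alpha k * dot (w k t) y + bregman psi gradpsi y (x k t))
         (x k.+1 t))
    (hu : forall k, (1 <= k)%N -> forall t,
       u k.+1 t = u k t + alpha k *: (El^T *m x k.+1 t))
    (K : nat) (hK : (1 <= K)%N),
  let xbar := fun t => (\sum_(1 <= k < K.+1) alpha k)^-1 *:
                         (\sum_(1 <= k < K.+1) alpha k *: x k.+1 t) in
  (('E_P[fun t => lagrangian f El (xbar t) ustar]
      - (lagrangian f El xstar ustar)%:E
    <= ((energy psi gradpsi xstar ustar x1 u1
           + sigma ^+ 2 * \sum_(1 <= k < K.+1) alpha k ^+ 2)
        / \sum_(1 <= k < K.+1) alpha k)%:E)%E : Prop).
Proof.
move=> El Lr X f psi hgradf hgradpsi hgamma hlambda xstar ustar hstar_feas hstar_X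
  hstar_opt d T P alpha halpha sigma eta heta_meas heta_indep heta_mean heta_var
  x1 u1 hx1 x w u hx_init hu_init hw hx hu K hK xbar.
have smf : convex_function X (fun z => beta / 2 * sqnorm z - f z).
  have := convex_separable_sum hf_smooth; congr convex_function.
  apply/funext => z; rewrite /separable_sum /f /separable_sum sqnorm_block.
  by rewrite mulr_sumr sumrB.
have scpsi : convex_function X (fun z => psi z - 2^-1 * sqnorm z).
  have := convex_separable_sum (fun _ : 'I_N => hpsi_sc); congr convex_function.
  apply/funext => z; rewrite /separable_sum /psi /separable_sum sqnorm_block.
  by rewrite mulr_sumr sumrB.
have alpha_gt0 k : (1 <= k)%N -> 0 < alpha k by move=> /halpha/andP[].
have alpha_le k : (1 <= k)%N -> alpha k * (beta + lambda) <= 2^-1.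
  move=> /halpha/andP[a0]; rewrite le_min => /andP[ale _].
  (* The positive step size forces [0 < beta + lambda], the inverse of zero being zero; only then
     can the bound be multiplied out. *)
  have : 0 < 1 / (2 * (beta + lambda)) by exact: lt_le_trans ale.
  rewrite div1r invr_gt0 pmulr_rgt0// => bl0.
  by move: ale; rewrite div1r invfM ler_pdivlMr.
have alphaE k : (1 <= k)%N -> forall y : 'cV[R]_(N * n),
    alpha k * sqnorm (El^T *m y) <= dot (Lr *m y) y.
  move=> /halpha/andP[a0]; rewrite le_min => /andP[_ ale] y.
  apply: weighted_incidence_le_laplacian => // [|j]; first exact: ltW.
  (* The maximum [1 / gamma] belongs to its set, and multiplication by [l 0 j] preserves the
     order. *)
  by apply: le_trans (hgamma.1 j); rewrite ler_wpM2r// ltW.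
have Lxs : Lr *m xstar = 0 by exact: weighted_laplacian_eq0 hl hstar_feas.
have symL : Lr^T = Lr by exact: trmx_weighted_laplacian.
have L_le y : dot (Lr *m y) y <= lambda * sqnorm y.
  exact: le_max_eigenvalue symL hlambda.2.
have L_ge0 y : 0 <= dot (Lr *m y) y by exact: weighted_laplacian_ge0.
have hx' k : (1 <= k)%N -> forall t, is_argmin X (fun y => alpha k *
    dot (Lr *m x k t + El *m u k t + gradf (x k t) + eta k t) y +
    bregman psi gradpsi y (x k t)) (x k.+1 t).
  by move=> k1 t; rewrite -hw//; exact: hx.
have cX : convex_set X by exact: convex_block_power.
have cf : convex_function X f by exact: convex_separable_sum.
exact: (@expected_gap_bound _ _ _ X f psi gradf gradpsi El Lr beta lambda xstar ustar
  cX hgradf hgradpsi cf smf scpsi symL L_ge0 L_le hstar_feas Lxs hstar_X hstar_opt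
  _ _ P alpha sigma eta alpha_gt0 alpha_le alphaE heta_meas heta_indep heta_mean heta_var
  x1 u1 x u hx1 hx_init hu_init hx' hu K hK).
Qed.
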